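(* (Tail-sum formula) Let $\rho$ be a density operator on $H$ and let $f\ge 0$ be a random variable. Then $$\int f\,d\mu_\rho=\int_0^\infty\mu_\rho\left(\{x\in\Omega: f(x)>\lambda\}\right)d\lambda,$$ where $d\lambda$ is Lebesgue measure on $\mathbb{R}$.
   Context: $(\Omega,\mathcal{A},\nu)$ is a probability space and $H=L_2(\Omega,\mathcal{A},\nu)$ is the complex Hilbert space with inner product $\langle f,g\rangle=\int\bar f g\,d\nu$. A random variable is a real-valued $f\in H$; $\chi_A$ is the characteristic function of $A\in\mathcal{A}$, and $\mu(A)$ is the operator $u\mapsto\left(\int_A u\,d\nu\right)\chi_A$ on $H$. A density operator is a positive trace-class operator of trace $1$; for a density operator $\rho$, $\mu_\rho(A)=\mathrm{tr}[\rho\mu(A)]$. For a random variable $f\ge 0$, its quantization $\widehat f$ is the operator $(\widehat f u)(y)=\int\min[f(x),f(y)]\,u(x)\,d\nu(x)$, and the $q$-integral is $\int f\,d\mu_\rho=\mathrm{tr}(\rho\widehat f)$. *)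

(* Defs.v *)
From HB Require Import structures.
From mathcomp Require Import all_boot all_order all_algebra.
From mathcomp Require Import all_classical all_reals all_analysis.
From mathcomp.real_closed Require Import complex.
Import Order.TTheory GRing.Theory Num.Theory.

Set Implicit Arguments.
Unset Strict Implicit.
Unset Printing Implicit Defensive.

Local Open Scope ring_scope.
Local Open Scope classical_set_scope.

(* Elements of H = L_2(Omega, A, nu) (complex) are represented by functions
   Omega -> R[i]; two representatives denote the same vector of H iff they
   are nu-a.e. equal.  Operators on H are represented by maps on
   representatives that preserve L_2 and a.e.-equality and are linear. *)

Definition cint (d : measure_display) (T : measurableType d) (R : realType)
  (mu : measure T R) (A : set T) (u : T -> R[i]) : R[i] :=
  Complex (Rintegral mu A (fun x => complex.Re (u x)))
          (Rintegral mu A (fun x => complex.Im (u x))).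

Definition L2 (d : measure_display) (T : measurableType d) (R : realType)
  (nu : measure T R) (u : T -> R[i]) : Prop :=
  measurable_fun setT (fun x => complex.Re (u x)) /\
  measurable_fun setT (fun x => complex.Im (u x)) /\
  (\int[nu]_x ((complex.Re (u x)) ^+ 2 + (complex.Im (u x)) ^+ 2)%:E < +oo)%E.

Definition ae_eq (d : measure_display) (T : measurableType d) (R : realType)
  (nu : measure T R) (u v : T -> R[i]) : Prop :=
  {ae nu, forall x, u x = v x}.

Definition inner (d : measure_display) (T : measurableType d) (R : realType)
  (nu : measure T R) (u v : T -> R[i]) : R[i] :=
  cint nu setT (fun x => (u x)^* * v x).

Definition operator (T : Type) (R : realType) := (T -> R[i]) -> (T -> R[i]).

Definition is_operator (d : measure_display) (T : measurableType d)
  (R : realType) (nu : measure T R) (A : operator T R) : Prop :=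
  (forall u, L2 nu u -> L2 nu (A u)) /\
  (forall u v, L2 nu u -> L2 nu v -> ae_eq nu u v -> ae_eq nu (A u) (A v)) /\
  (forall (a : R[i]) u v, L2 nu u -> L2 nu v ->
     ae_eq nu (A (fun x => a * u x + v x)) (fun x => a * A u x + A v x)).

Definition positive_op (d : measure_display) (T : measurableType d)
  (R : realType) (nu : measure T R) (A : operator T R) : Prop :=
  forall u, L2 nu u -> 0 <= inner nu u (A u).

(* orthonormal basis of H (a maximal orthonormal set, possibly uncountable) *)
Definition onb (d : measure_display) (T : measurableType d) (R : realType)
  (nu : measure T R) (S : set (T -> R[i])) : Prop :=
  (forall e, S e -> L2 nu e) /\
  (forall e, S e -> inner nu e e = 1) /\
  (forall e e', S e -> S e' -> e <> e' -> inner nu e e' = 0) /\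
  (forall u, L2 nu u -> (forall e, S e -> inner nu e u = 0) ->
     ae_eq nu u (fun=> 0)).

(* tr X = t : for every orthonormal basis S, the unordered sum
   sum_{e in S} <e, X e> converges (as a net over finite subsets of S) to t *)
Definition has_trace (d : measure_display) (T : measurableType d)
  (R : realType) (nu : measure T R) (X : operator T R) (t : R[i]) : Prop :=
  forall S, onb nu S ->
  forall eps : R, 0 < eps ->
  exists F0 : set (T -> R[i]), [/\ finite_set F0, F0 `<=` S &
    forall F : set (T -> R[i]), finite_set F -> F0 `<=` F -> F `<=` S ->
      `| \sum_(e \in F) inner nu e (X e) - t | < (eps%:C)%C].

Definition trace (d : measure_display) (T : measurableType d)
  (R : realType) (nu : measure T R) (X : operator T R) : R[i] :=
  xget 0 [set t | has_trace nu X t].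

Definition density (d : measure_display) (T : measurableType d)
  (R : realType) (nu : measure T R) (rho : operator T R) : Prop :=
  [/\ is_operator nu rho, positive_op nu rho & has_trace nu rho 1].

Definition muop (d : measure_display) (T : measurableType d)
  (R : realType) (nu : measure T R) (A : set T) : operator T R :=
  fun u y => cint nu A u * ((\1_A y)%:C)%C.

Definition mu_rho (d : measure_display) (T : measurableType d)
  (R : realType) (nu : measure T R) (rho : operator T R) (A : set T) : R[i] :=
  trace nu (fun u => rho (muop nu A u)).

Definition quant (d : measure_display) (T : measurableType d)
  (R : realType) (nu : measure T R) (f : T -> R) : operator T R :=
  fun u y => cint nu setT (fun x => ((Num.min (f x) (f y))%:C)%C * u x).

Definition qint (d : measure_display) (T : measurableType d)
  (R : realType) (nu : measure T R) (rho : operator T R) (f : T -> R) : R[i] :=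
  trace nu (fun u => rho (quant nu f u)).

(* Main.v *)
Require Import Defs.
From HB Require Import structures.
From mathcomp Require Import all_boot all_order all_algebra.
From mathcomp Require Import all_classical all_reals all_analysis.
From mathcomp.real_closed Require Import complex.
From mathcomp Require Import measurable_realfun ring lra.
Import Order.TTheory GRing.Theory Num.Theory.

(* Fix a finite orthonormal family s of vectors of H and write
   delta = 1 - sum_{e in s} <e, rho e>.  Completing s to an orthonormal basis
   and using tr rho = 1 shows that <v, rho v> <= |v|^2 delta for every v
   orthogonal to s.  Applied to v = u - sum_{e in s} <e, u> e, the
   Cauchy-Schwarz inequality for the positive form <., rho .> gives
     |sum_{e in s} <u, e><e, rho w> - <u, rho w>|^2 <= |u|^2 |w|^2 delta,
   and delta tends to 0 along the finite subsets of any orthonormal basis.  So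
   rho |w><u| has trace <u, rho w> (no Parseval identity, hence no completeness
   of L_2, is needed); in particular mu_rho(A) = <chi_A, rho chi_A>.  Since
   min(f(x), f(y)) is the integral over l >= 0 of chi_{f>l}(x) chi_{f>l}(y),
   Fubini turns <e, rho f^ e> into the integral of
   <chi_{f>l}, e><e, rho chi_{f>l}>, and the same inequality, uniform in l up to
   the integrable factor nu(f > l), passes to the limit under the integral. *)

Set Implicit Arguments.
Unset Strict Implicit.
Unset Printing Implicit Defensive.

Local Open Scope ring_scope.
Local Open Scope classical_set_scope.

(** * Positive semidefinite sesquilinear forms *)

(** Vectors are representatives singled out by a predicate, and [lin a u v] stands for a u + v.
    Definiteness is left out so that <., rho .> qualifies along with [inner]; Hermitian symmetry is
    derived below. *)
Definition psd_form {C : numClosedFieldType} {V : Type} (P : V -> Prop)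
    (lin : C -> V -> V -> V) (B : V -> V -> C) : Prop :=
  [/\ forall a u v, P u -> P v -> P (lin a u v),
      forall a u v w, P u -> P v -> P w -> B w (lin a u v) = a * B w u + B w v,
      forall a u v w, P u -> P v -> P w -> B (lin a u v) w = a^* * B u w + B v w
    & forall u, P u -> 0 <= B u u].

Lemma psd_form_expand {C : numClosedFieldType} {V : Type} (P : V -> Prop)
    (lin : C -> V -> V -> V) (B : V -> V -> C) : psd_form P lin B ->
  forall a u v, P u -> P v ->
  0 <= a * a^* * B u u + a^* * B u v + a * B v u + B v v.
Proof.
move=> [Pl Br Bl B0] a u v Pu Pv.
have := B0 _ (Pl a u v Pu Pv).
rewrite Br ?Bl //; last exact: Pl.
suff -> : a * (a^* * B u u + B v u) + (a^* * B u v + B v v) =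
  a * a^* * B u u + a^* * B u v + a * B v u + B v v by [].
by ring.
Qed.

(** Polarization: the diagonal is real, so a^* B(u, v) + a B(v, u) is real for every a; the values a
    = 1 and a = 'i determine B(v, u). *)
Lemma psd_form_conj {C : numClosedFieldType} {V : Type} (P : V -> Prop)
    (lin : C -> V -> V -> V) (B : V -> V -> C) : psd_form P lin B ->
  forall u v, P u -> P v -> B v u = (B u v)^*.
Proof.
move=> HB u v Pu Pv; have [_ _ _ B0] := HB.
have re0 a : a * a^* * B u u + B v v \is Num.real.
  by rewrite ger0_real // addr_ge0 ?B0 // mulr_ge0 ?mul_conjC_ge0 ?B0.
have H a : (a^* * B u v + a * B v u)^* = a^* * B u v + a * B v u.
  apply/CrealP; have := ger0_real (psd_form_expand HB a Pu Pv).
  suff -> : a * a^* * B u u + a^* * B u v + a * B v u + B v v =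
    (a * a^* * B u u + B v v) + (a^* * B u v + a * B v u) by rewrite rpredDl.
  by ring.
have h1 : 'i * (B u v)^* + - 'i * (B v u)^* = - 'i * B u v + 'i * B v u.
  by have := H 'i; rewrite conjCi rmorphD !rmorphM /= rmorphN /= conjCi opprK.
have h2 : (B u v)^* + (B v u)^* = B u v + B v u.
  by have := H 1; rewrite conjC1 !mul1r rmorphD.
have i0 : 'i != 0 :> C by rewrite neq0Ci.
have h3 : (B u v)^* - (B v u)^* = - (B u v) + B v u.
  apply: (mulfI i0); rewrite mulrBr -mulNr h1; ring.
have : ((B u v)^* - (B v u)^*) + ((B u v)^* + (B v u)^*) = (B v u) *+ 2.
  by rewrite h3 h2 mulr2n; ring.
have -> : ((B u v)^* - (B v u)^*) + ((B u v)^* + (B v u)^*) = (B u v)^* *+ 2.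
  by rewrite mulr2n; ring.
by move/eqP; rewrite eqr_pMn2r // => /eqP.
Qed.

Lemma psd_form_CS {C : numClosedFieldType} {V : Type} (P : V -> Prop)
    (lin : C -> V -> V -> V) (B : V -> V -> C) : psd_form P lin B ->
  forall u v, P u -> P v -> `|B u v| ^+ 2 <= B u u * B v v.
Proof.
move=> HB u v Pu Pv; have [_ _ _ B0] := HB.
have E a : 0 <= a * a^* * B u u + a^* * B u v + a * (B u v)^* + B v v.
  by rewrite -(psd_form_conj HB Pu Pv); exact: (psd_form_expand HB).
set p := B u u in E *; set q := B v v in E *; set h := B u v in E *.
have p0 : 0 <= p by exact: B0.
have q0 : 0 <= q by exact: B0.
(* If B(u, u) = 0, taking a = - t h gives 2 t |h|^2 <= q for all t >= 0; the choice t = (q + 1) /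
   |h|^2 then refutes h <> 0. *)
have [p00|pn0] := eqVneq p 0.
  have E' (t : C) : 0 <= t -> t * `|h| ^+ 2 *+ 2 <= q.
    move=> t0; have := E (- (t * h)).
    have tc : t^* = t by apply/CrealP; exact: ger0_real.
    rewrite p00 mulr0 add0r rmorphN rmorphM /= tc.
    suff -> : - (t * h^*) * h + - (t * h) * h^* + q = q - t * `|h| ^+ 2 *+ 2.
      by rewrite subr_ge0.
    by rewrite normCK mulr2n; ring.
  have [->|hn0] := eqVneq h 0; first by rewrite normr0 expr0n /= mulr_ge0 // ?B0.
  have h2 : 0 < `|h| ^+ 2 by rewrite exprn_gt0 ?normr_gt0.
  have /E' : 0 <= (q + 1) / `|h| ^+ 2.
    by apply: divr_ge0; [exact: addr_ge0 | exact: ltW].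
  rewrite divfK ?gt_eqF // => h1.
  have : q + 1 <= q.
    by apply: le_trans h1; rewrite mulr2n lerDl addr_ge0.
  by rewrite gerDl ler10.
have pp : 0 < p by rewrite lt_def pn0.
have pc : (- (h / p))^* = - (h^* / p).
  rewrite rmorphN rmorphM /=; congr (- (_ * _)).
  by apply/CrealP; rewrite ger0_real // invr_ge0.
(* This a minimizes the quadratic expression, whose minimum is q - |h|^2 / p. *)
have := E (- (h / p)); rewrite pc.
suff -> : - (h / p) * - (h^* / p) * p + - (h^* / p) * h + - (h / p) * h^* + q =
  q - `|h| ^+ 2 / p.
  by rewrite subr_ge0 ler_pdivrMr // mulrC.
by rewrite normCK; field.
Qed.

(** * Complex numbers in coordinates *)

Lemma conjcE (R : rcfType) (z : R[i]) :
  z^* = Complex (complex.Re z) (- complex.Im z).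
Proof. by case: z. Qed.

Lemma creD (R : rcfType) (z w : R[i]) :
  complex.Re (z + w) = complex.Re z + complex.Re w.
Proof. by case: z; case: w. Qed.

Lemma cimD (R : rcfType) (z w : R[i]) :
  complex.Im (z + w) = complex.Im z + complex.Im w.
Proof. by case: z; case: w. Qed.

Lemma creM (R : rcfType) (z w : R[i]) : complex.Re (z * w) =
  complex.Re z * complex.Re w - complex.Im z * complex.Im w.
Proof. by case: z; case: w. Qed.

Lemma cimM (R : rcfType) (z w : R[i]) : complex.Im (z * w) =
  complex.Re z * complex.Im w + complex.Im z * complex.Re w.
Proof. by case: z; case: w. Qed.

Lemma eqcP (R : rcfType) (z w : R[i]) : complex.Re z = complex.Re w ->
  complex.Im z = complex.Im w -> z = w.
Proof. by case: z; case: w => /= a b c d -> ->. Qed.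

Definition flin {T : Type} {R : realType} (a : R[i]) (u v : T -> R[i]) :=
  fun x => a * u x + v x.

(** * Integration of complex functions and the inner product *)

Section cintegrable.
Context {d : measure_display} {T : measurableType d} {R : realType}.
Variable mu : {measure set T -> \bar R}.

Definition rintegrable (f : T -> R) := mu.-integrable setT (EFin \o f).

Lemma rintegrableD f g : rintegrable f -> rintegrable g ->
  rintegrable (fun x => f x + g x).
Proof. exact: integrableD. Qed.

Lemma rintegrableZ k f : rintegrable f -> rintegrable (fun x => k * f x).
Proof. by move=> /(integrableZl measurableT k). Qed.

Lemma rintegrableB f g : rintegrable f -> rintegrable g ->
  rintegrable (fun x => f x - g x).
Proof. exact: integrableB. Qed.

Lemma rintegrable_mfun (f : T -> R) : rintegrable f -> measurable_fun setT f.
Proof. by move=> /measurable_int /measurable_EFinP. Qed.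

Lemma rintegrable_le (f g : T -> R) : measurable_fun setT f -> rintegrable g ->
  (forall x, `|f x| <= g x) -> rintegrable f.
Proof.
move=> mf ig fg; apply: le_integrable ig => //.
  exact/measurable_EFinP.
by move=> x _ /=; rewrite lee_fin (le_trans (fg x))// ler_norm.
Qed.

Definition cintegrable (u : T -> R[i]) :=
  rintegrable (fun x => complex.Re (u x)) /\
  rintegrable (fun x => complex.Im (u x)).

Lemma cintegrable_lin a u v : cintegrable u -> cintegrable v ->
  cintegrable (flin a u v).
Proof.
move=> [ur ui] [vr vi]; split.
- under eq_fun do rewrite /flin creD creM.
  by apply: rintegrableD => //; apply: rintegrableB; exact: rintegrableZ.
- under eq_fun do rewrite /flin cimD cimM.
  by apply: rintegrableD => //; apply: rintegrableD; exact: rintegrableZ.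
Qed.

Lemma cint_lin a u v : cintegrable u -> cintegrable v ->
  cint mu setT (flin a u v) = a * cint mu setT u + cint mu setT v.
Proof.
move=> [ur ui] [vr vi]; apply: eqcP.
- rewrite creD creM /cint /=; under eq_Rintegral do rewrite /flin creD creM.
  rewrite RintegralD //; last by apply: rintegrableB; exact: rintegrableZ.
  by rewrite RintegralB ?RintegralZl //; exact: rintegrableZ.
- rewrite cimD cimM /cint /=; under eq_Rintegral do rewrite /flin cimD cimM.
  rewrite RintegralD //; last by apply: rintegrableD; exact: rintegrableZ.
  by rewrite RintegralD ?RintegralZl //; exact: rintegrableZ.
Qed.

Lemma cint_conj u : cintegrable u ->
  cint mu setT (fun x => (u x)^*) = (cint mu setT u)^*.
Proof.
move=> [ur ui]; rewrite conjcE /cint /=; congr Complex.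
  by apply: eq_Rintegral => x _; rewrite conjcE.
under eq_Rintegral do rewrite conjcE /= -mulN1r.
by rewrite RintegralZl // mulN1r.
Qed.

Lemma eq_cint A u v : {in A, u =1 v} -> cint mu A u = cint mu A v.
Proof.
by move=> uv; congr Complex; apply: eq_Rintegral => x xA; rewrite uv.
Qed.

Lemma cint_indic A u :
  cint mu A u = cint mu setT (fun x => ((\1_A x)%:C)%C * u x).
Proof.
rewrite /cint !(Rintegral_mkcond _ A).
by congr Complex; apply: eq_Rintegral => x _; rewrite ?creM ?cimM /= mul0r
  ?subr0 ?addr0 /patch indicE; case: ifP => _; rewrite ?mul1r ?mul0r.
Qed.

Definition sqn (u : T -> R[i]) x := complex.Re (u x) ^+ 2 + complex.Im (u x) ^+ 2.

Lemma sqn_ge0 u x : 0 <= sqn u x.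
Proof. by rewrite addr_ge0 ?sqr_ge0. Qed.

Lemma L2_sqn u : L2 mu u -> rintegrable (sqn u).
Proof.
move=> [mr [mi fin]]; apply/integrableP; split.
  by apply/measurable_EFinP; apply: measurable_funD; apply: measurable_funX.
rewrite (eq_integral (fun x => (sqn u x)%:E)) // => x _ /=.
by rewrite ger0_norm // sqn_ge0.
Qed.

Lemma L2P u : measurable_fun setT (fun x => complex.Re (u x)) ->
  measurable_fun setT (fun x => complex.Im (u x)) ->
  rintegrable (sqn u) -> L2 mu u.
Proof.
move=> mr mi /integrableP[_ fin]; split=> //; split=> //.
rewrite (eq_integral (fun x => `|(sqn u x)%:E|%E)) // => x _ /=.
by rewrite ger0_norm // sqn_ge0.
Qed.

Lemma L2_lin a u v : L2 mu u -> L2 mu v -> L2 mu (flin a u v).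
Proof.
move=> Lu Lv; have [ur [ui _]] := Lu; have [vr [vi _]] := Lv.
have mr : measurable_fun setT (fun x => complex.Re (flin a u v x)).
  under eq_fun do rewrite /flin creD creM.
  by apply: measurable_funD => //; apply: measurable_funB;
    apply: measurable_funM.
have mi : measurable_fun setT (fun x => complex.Im (flin a u v x)).
  under eq_fun do rewrite /flin cimD cimM.
  by apply: measurable_funD => //; apply: measurable_funD;
    apply: measurable_funM.
apply: L2P => //.
(* Parallelogram law: the bound 2 |a u|^2 + 2 |v|^2 exceeds |a u + v|^2 by exactly |a u - v|^2. *)
apply: (@rintegrable_le _ (fun x => (2 * (complex.Re a ^+ 2 + complex.Im a ^+ 2)) * sqn u x
    + 2 * sqn v x)).
- by apply: measurable_funD; apply: measurable_funX.
- by apply: rintegrableD; apply: rintegrableZ; apply: L2_sqn.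
move=> x; rewrite ger0_norm ?sqn_ge0 // /sqn /flin creD cimD creM cimM.
set p := complex.Re a; set q := complex.Im a.
set r := complex.Re (u x); set s := complex.Im (u x).
set t := complex.Re (v x); set w := complex.Im (v x).
have h1 := sqr_ge0 (p * r - q * s - t).
have h2 := sqr_ge0 (p * s + q * r - w).
rewrite -subr_ge0; suff -> : 2 * (p ^+ 2 + q ^+ 2) * (r ^+ 2 + s ^+ 2) + 2 * (t ^+ 2 + w ^+ 2)
   - ((p * r - q * s + t) ^+ 2 + (p * s + q * r + w) ^+ 2) =
   (p * r - q * s - t) ^+ 2 + (p * s + q * r - w) ^+ 2 by rewrite addr_ge0.
by ring.
Qed.

(** Domination of |f g| by f^2 + g^2. Real functions below |u| and |v| are allowed so that all
    products of real and imaginary parts are covered at once. *)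
Lemma L2_mulr (f g : T -> R) (u v : T -> R[i]) : L2 mu u -> L2 mu v ->
  measurable_fun setT f -> measurable_fun setT g ->
  (forall x, f x ^+ 2 <= sqn u x) -> (forall x, g x ^+ 2 <= sqn v x) ->
  rintegrable (fun x => f x * g x).
Proof.
move=> Lu Lv mf mg fu gv.
apply: (@rintegrable_le _ (fun x => sqn u x + sqn v x)).
- exact: measurable_funM.
- by apply: rintegrableD; apply: L2_sqn.
move=> x; apply: le_trans (lerD (fu x) (gv x)).
rewrite ler_norml; have h1 := sqr_ge0 (f x - g x); have h2 := sqr_ge0 (f x + g x).
by apply/andP; split; nra.
Qed.

Lemma L2_cintegrable u v : L2 mu u -> L2 mu v ->
  cintegrable (fun x => (u x)^* * v x).
Proof.
move=> Lu Lv; have [ur [ui _]] := Lu; have [vr [vi _]] := Lv.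
have re (w : T -> R[i]) x : complex.Re (w x) ^+ 2 <= sqn w x.
  by rewrite /sqn lerDl sqr_ge0.
have im (w : T -> R[i]) x : complex.Im (w x) ^+ 2 <= sqn w x.
  by rewrite /sqn lerDr sqr_ge0.
split.
- under eq_fun do rewrite conjcE creM /= mulNr opprK.
  by apply: rintegrableD; apply: (L2_mulr Lu Lv).
- under eq_fun do rewrite conjcE cimM /= mulNr.
  by apply: rintegrableB; apply: (L2_mulr Lu Lv).
Qed.

Lemma inner_conj u v : L2 mu u -> L2 mu v -> inner mu v u = (inner mu u v)^*.
Proof.
move=> Lu Lv; rewrite /inner -cint_conj; last exact: L2_cintegrable.
by apply: eq_cint => x _; rewrite rmorphM /= conjCK mulrC.
Qed.

Lemma inner_self u : inner mu u u = Complex (\int[mu]_x sqn u x) 0.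
Proof.
rewrite /inner /cint; congr Complex.
  by apply: eq_Rintegral => x _; rewrite conjcE creM /sqn /=; ring.
rewrite (@eq_Rintegral _ _ _ _ _ (fun=> 0)); last first.
  by move=> x _; rewrite conjcE cimM /=; ring.
by rewrite Rintegral_cst // mul0r.
Qed.

Lemma inner_psd : psd_form (L2 mu) flin (inner mu).
Proof.
have R_lin a u v w : L2 mu u -> L2 mu v -> L2 mu w ->
    inner mu w (flin a u v) = a * inner mu w u + inner mu w v.
  move=> Lu Lv Lw; rewrite /inner -cint_lin; try exact: L2_cintegrable.
  by apply: eq_cint => x _; rewrite /flin; ring.
split=> //.
- by move=> a u v; exact: L2_lin.
- move=> a u v w Lu Lv Lw; rewrite !(@inner_conj w) //; last exact: L2_lin.
  by rewrite R_lin // rmorphD rmorphM.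
- move=> u Lu; rewrite inner_self lecE /= eqxx /=.
  by apply: Rintegral_ge0 => x _; exact: sqn_ge0.
Qed.

(** Operators are linear only almost everywhere; this is what transfers their linearity to exact
    identities between inner products. *)
Lemma inner_aer u v w : L2 mu u -> L2 mu v -> L2 mu w ->
  {ae mu, forall x, v x = w x} -> inner mu u v = inner mu u w.
Proof.
move=> Lu Lv Lw vw; have [v1 v2] := L2_cintegrable Lu Lv.
have [w1 w2] := L2_cintegrable Lu Lw.
congr Complex; congr fine; apply: ae_eq_integral => //.
- exact: measurable_int v1.
- exact: measurable_int w1.
- by apply: filterS vw => x /= ->.
- exact: measurable_int v2.
- exact: measurable_int w2.
- by apply: filterS vw => x /= ->.
Qed.

Lemma inner_self_eq0 u : L2 mu u -> inner mu u u = 0 ->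
  {ae mu, forall x, u x = 0}.
Proof.
move=> Lu; rewrite inner_self => -[] u0.
have iu := L2_sqn Lu.
have : (\int[mu]_x `|(sqn u x)%:E| = 0)%E.
  under eq_integral do rewrite gee0_abs ?lee_fin ?sqn_ge0 //.
  rewrite -[LHS]fineK ?integrable_fin_num //; first by congr EFin.
move/(ae_eq_integral_abs mu measurableT (measurable_int _ iu)).
apply: filterS => x /= /(_ I) [] /eqP.
rewrite paddr_eq0 ?sqr_ge0 // !sqrf_eq0 => /andP[/eqP re /eqP im].
exact: eqcP.
Qed.

End cintegrable.

(** * Orthonormal bases and traces *)

Section trace.
Context {d : measure_display} {T : measurableType d} {R : realType}.
Variable nu : {measure set T -> \bar R}.
Implicit Types (u v w e : T -> R[i]) (s : seq (T -> R[i])).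

Definition orthonormal_set (S : set (T -> R[i])) : Prop :=
  [/\ forall e, S e -> L2 nu e, forall e, S e -> inner nu e e = 1 &
      forall e e', S e -> S e' -> e <> e' -> inner nu e e' = 0].

Lemma L2_0 : L2 nu (fun=> 0).
Proof.
apply: L2P => //=.
rewrite (_ : sqn _ = fun=> 0); first exact: integrable0.
by apply/funext => x; rewrite /sqn /= expr0n /= addr0.
Qed.

Lemma psd_form0r B w : psd_form (L2 nu) flin B -> L2 nu w -> B w (fun=> 0) = 0.
Proof.
move=> [_ Br _ _] Lw; have := Br 1 _ _ _ L2_0 L2_0 Lw.
rewrite mul1r (_ : flin 1 _ _ = fun=> 0); last first.
  by apply/funext => y; rewrite /flin mulr0 addr0.
by move/eqP; rewrite -subr_eq subrr => /eqP.
Qed.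

Lemma psd_form0l B w : psd_form (L2 nu) flin B -> L2 nu w -> B (fun=> 0) w = 0.
Proof.
by move=> HB Lw; rewrite (psd_form_conj HB Lw L2_0) psd_form0r ?rmorph0.
Qed.

Lemma psd_formZr B a u w : psd_form (L2 nu) flin B -> L2 nu u -> L2 nu w ->
  B w (flin a u (fun=> 0)) = a * B w u.
Proof.
move=> HB Lu Lw; have [_ Br _ _] := HB.
by rewrite Br ?psd_form0r ?addr0 //; exact: L2_0.
Qed.

Lemma psd_formZl B a u w : psd_form (L2 nu) flin B -> L2 nu u -> L2 nu w ->
  B (flin a u (fun=> 0)) w = a^* * B u w.
Proof.
move=> HB Lu Lw; have [_ _ Bl _] := HB.
by rewrite Bl ?psd_form0l ?addr0 //; exact: L2_0.
Qed.

Lemma normalize u : L2 nu u -> inner nu u u != 0 -> exists a,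
  [/\ a^* = a, a * a = (inner nu u u)^-1 &
    inner nu (flin a u (fun=> 0)) (flin a u (fun=> 0)) = 1].
Proof.
move=> Lu un0; have [_ _ _ /(_ u Lu) c0] := inner_psd nu.
set c := inner nu u u in c0 un0 *; pose a := (sqrtC c)^-1.
have ar : a^* = a.
  by apply/CrealP; rewrite ger0_real // invr_ge0 sqrtC_ge0.
have aa : a * a = c^-1 by rewrite -expr2 /a exprVn sqrtCK.
exists a; split=> //; have Lv : L2 nu (flin a u (fun=> 0)).
  by apply: L2_lin => //; exact: L2_0.
rewrite (psd_formZr _ (inner_psd nu)) // (psd_formZl _ (inner_psd nu)) // ar.
by rewrite mulrA aa mulVf.
Qed.

(** Zorn's lemma for the sets S with G [|] S orthonormal, ordered by inclusion. A non-null vector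
    orthogonal to a maximal such union could be normalized and added to it. *)
Lemma onb_extend G : orthonormal_set G -> exists2 S, onb nu S & G `<=` S.
Proof.
move=> oG.
have [|A [oA maxA]] := @Zorn_bigcup _ (fun S => orthonormal_set (G `|` S)).
  move=> F FP tF; have [LG G1 G0] := oG; split.
  - by move=> e [/LG//|[X FX Xe]]; have [H _ _] := FP _ FX; apply: H; right.
  - by move=> e [/G1//|[X FX Xe]]; have [_ H _] := FP _ FX; apply: H; right.
  - move=> e e' [Ge|[X FX Xe]] [Ge'|[Y FY Ye']].
    + exact: G0.
    + by have [_ _ H] := FP _ FY; apply: H; [left|right].
    + by have [_ _ H] := FP _ FX; apply: H; [right|left].
    + have [XY|YX] := tF _ _ FX FY.
        by have [_ _ H] := FP _ FY; apply: H; right => //; exact: XY.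
      by have [_ _ H] := FP _ FX; apply: H; right => //; exact: YX.
exists (G `|` A); last by move=> e; left.
have [LS S1 S0] := oA; split=> //; split=> //; split=> // u Lu uS.
apply: contrapT => un0.
have un1 : inner nu u u != 0 by apply/eqP => /(inner_self_eq0 Lu).
have [a [_ _]] := normalize Lu un1; set v := flin a u _ => v1.
have Lv : L2 nu v by apply: L2_lin => //; exact: L2_0.
have vS e : (G `|` A) e -> inner nu e v = 0.
  move=> Se; rewrite /v (psd_formZr _ (inner_psd nu)) ?uS ?mulr0 //.
  exact: LS.
have vnS : ~ (G `|` A) v by move=> /vS; rewrite v1 => /eqP; rewrite oner_eq0.
apply: (maxA (A `|` [set v])).
  split; last by move=> /(_ v) AS; apply: vnS; right; apply: AS; right.
  by move=> e; left.
rewrite setUA; split.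
- by move=> e [/LS//|->].
- by move=> e [/S1//|->].
- move=> e e' [Se|->] [Se'|->] //.
  + exact: S0.
  + by move=> _; exact: vS.
  + by move=> _; rewrite (@inner_conj _ _ _ _ e' v) ?vS ?rmorph0 //; exact: LS.
Qed.

(** [has_trace] quantifies over all bases, so uniqueness rests on the existence of one, obtained by
    extending the empty family. On it both nets are compared at the union of their two
    thresholds. *)
Lemma has_trace_unique X t t' : has_trace nu X t -> has_trace nu X t' -> t = t'.
Proof.
move=> tX tX'.
have [|S oS _] := @onb_extend set0; first by split.
apply/eqP; rewrite -subr_eq0 -normr_le0 normc_def.
have [tt|] := lerP (Num.sqrt (complex.Re (t - t') ^+ 2 + complex.Im (t - t') ^+ 2)) 0.
  by rewrite lecR.
set r := Num.sqrt _ => r0.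
(* Here r = |t - t'|; two errors below r / 2 would give r < r. *)
have r2 : 0 < r / 2 by rewrite divr_gt0.
have [F0 [fF0 F0S H]] := tX S oS _ r2.
have [F1 [fF1 F1S H']] := tX' S oS _ r2.
have FS : F0 `|` F1 `<=` S by rewrite subUset.
have fF : finite_set (F0 `|` F1) by rewrite finite_setU.
have := H _ fF (@subsetUl _ _ _) FS; have := H' _ fF (@subsetUr _ _ _) FS.
set z := \sum_(e \in _) _ => h1 h2.
have : `|t - t'| < (r%:C)%C.
  rewrite (_ : r = r / 2 + r / 2); last by rewrite -splitr.
  rewrite rmorphD /= (_ : t - t' = (t - z) + (z - t')); last by ring.
  by apply: le_lt_trans (ler_normD _ _) _; apply: ltrD => //; rewrite distrC.
by rewrite normc_def -/r ltxx.
Qed.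

Lemma has_traceE X t : has_trace nu X t -> trace nu X = t.
Proof.
move=> tX; rewrite /trace; case: xgetP => [t' _ tX'|]; last by move=> /(_ t).
exact: has_trace_unique tX' tX.
Qed.

Lemma ler_sum_sub {I : eqType} {C : numDomainType} (F : I -> C) (s t : seq I) :
  uniq s -> uniq t -> {subset s <= t} -> (forall i, i \in t -> 0 <= F i) ->
  \sum_(i <- s) F i <= \sum_(i <- t) F i.
Proof.
move=> us ut st F0; have st' : perm_eq [seq i <- t | i \in s] s.
  apply: uniq_perm; rewrite ?filter_uniq // => i.
  by rewrite mem_filter; case: (boolP (i \in s)) => // /st ->.
rewrite [leRHS](bigID (mem s)) /= -[X in _ <= X + _]big_filter (perm_big _ st').
by rewrite lerDl big_seq_cond; apply: sumr_ge0 => i /andP[/F0].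
Qed.

(* u minus its orthogonal projection on the span of s. *)
Definition resid s u := foldr (fun e w => flin (- inner nu e u) e w) u s.

Lemma resid_L2 s u : (forall e, e \in s -> L2 nu e) -> L2 nu u ->
  L2 nu (resid s u).
Proof.
move=> + Lu; elim: s => //= e s IH Ls; apply: L2_lin.
  by apply: Ls; rewrite mem_head.
by apply: IH => e' es; apply: Ls; rewrite in_cons es orbT.
Qed.

Section psd.
Variable B : (T -> R[i]) -> (T -> R[i]) -> R[i].
Hypothesis HB : psd_form (L2 nu) flin B.

(** The projection coefficients come from [inner], but the form B is arbitrary: B = [inner] yields
    orthogonality and the norm bound, and B = <., rho .> yields the trace estimate. *)
Lemma psd_residr s u w : (forall e, e \in s -> L2 nu e) -> L2 nu u -> L2 nu w ->
  B w (resid s u) = B w u - \sum_(e <- s) inner nu e u * B w e.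
Proof.
move=> + Lu Lw; have [_ Br _ _] := HB.
elim: s => [|e s IH] Ls /=; first by rewrite big_nil subr0.
have Ls' e' : e' \in s -> L2 nu e' by move=> es; apply: Ls; rewrite in_cons es orbT.
rewrite Br // ?big_cons ?IH //; first by ring.
  by apply: Ls; rewrite mem_head.
exact: resid_L2.
Qed.

Lemma psd_residl s u w : (forall e, e \in s -> L2 nu e) -> L2 nu u -> L2 nu w ->
  B (resid s u) w = B u w - \sum_(e <- s) inner nu u e * B e w.
Proof.
move=> + Lu Lw; have [_ _ Bl _] := HB.
elim: s => [|e s IH] Ls /=; first by rewrite big_nil subr0.
have Ls' e' : e' \in s -> L2 nu e' by move=> es; apply: Ls; rewrite in_cons es orbT.
have Le : L2 nu e by apply: Ls; rewrite mem_head.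
rewrite Bl // ?big_cons ?IH //; last exact: resid_L2.
by rewrite rmorphN /= -inner_conj //; ring.
Qed.

End psd.

Lemma resid_orth s u : uniq s -> orthonormal_set [set` s] -> L2 nu u ->
  forall e, e \in s -> inner nu e (resid s u) = 0.
Proof.
move=> us [Ls s1 s0] Lu e es; have Le := Ls _ es.
rewrite (psd_residr (inner_psd nu)) // (bigD1_seq e) //= s1 // mulr1.
rewrite big_seq_cond big1 ?addr0 ?subrr // => e' /andP[es' /eqP ee'].
by rewrite (s0 e e') ?mulr0 // => ee; apply: ee'.
Qed.

(** Since r = [resid s u] is orthogonal to s, <r, r> = <u, r> = <u, u> - sum_{e in s} |<e, u>|^2. *)
Lemma resid_le s u : uniq s -> orthonormal_set [set` s] -> L2 nu u ->
  inner nu (resid s u) (resid s u) <= inner nu u u.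
Proof.
move=> us os Lu; have [Ls _ _] := os; have Lr := resid_L2 Ls Lu.
rewrite (psd_residl (inner_psd nu)) // big_seq big1 ?subr0; last first.
  by move=> e es; rewrite resid_orth ?mulr0.
rewrite (psd_residr (inner_psd nu)) // lerBlDr lerDl big_seq.
apply: sumr_ge0 => e es; rewrite (inner_conj (Ls _ es) Lu) mulrC.
by rewrite mulrC mul_conjC_ge0.
Qed.

(** * Density operators tested on finite orthonormal families *)

Section density.
Variable rho : operator T R.
Hypothesis Hrho : density nu rho.

Let B u v := inner nu u (rho v).

Lemma rho_L2 u : L2 nu u -> L2 nu (rho u).
Proof. by have [[H _] _ _] := Hrho; exact: H. Qed.

Lemma density_psd : psd_form (L2 nu) flin (fun u v => inner nu u (rho v)).
Proof.
have [[_ [_ rl]] rp _] := Hrho; have [_ Ir Il _] := inner_psd nu.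
split=> //.
- by move=> a u v; exact: L2_lin.
- move=> a u v w Lu Lv Lw.
  rewrite (@inner_aer _ _ _ _ _ _ (flin a (rho u) (rho v))) ?Ir //; try exact: rho_L2.
  + by apply: rho_L2; exact: L2_lin.
  + by apply: L2_lin; exact: rho_L2.
  + exact: rl.
- by move=> a u v w Lu Lv Lw; rewrite Il //; exact: rho_L2.
Qed.

(** In a basis containing s the terms <e, rho e> are nonnegative, so finite sums grow with the
    family and cannot exceed their limit 1. *)
Lemma density_sum_le1 s : uniq s -> orthonormal_set [set` s] ->
  \sum_(e <- s) inner nu e (rho e) <= 1.
Proof.
move=> us os; have [_ rp tr] := Hrho; have [Ls _ _] := os.
have [S oS sS] := onb_extend os; have [LS _] := oS.
have B0 e : S e -> 0 <= B e e by move=> /LS /rp.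
have s0 : 0 <= \sum_(e <- s) B e e.
  by rewrite big_seq; apply: sumr_ge0 => e es; apply: B0; exact: sS.
(* The order on complex numbers requires equal imaginary parts; a nonnegative sum is real, which
   leaves an inequality between real parts. *)
rewrite lecE (ger0_Im s0) eqxx /=.
apply/ler_addgt0Pr => eps eps0.
have [F0 [/finite_seqP[t ->] tS H]] := tr S oS _ eps0.
have FS : [set` undup (t ++ s)] `<=` S.
  by move=> e /=; rewrite mem_undup mem_cat => /orP[/tS|/sS].
(* This family lies beyond the threshold t and also contains s. *)
have /(H _) : finite_set [set` undup (t ++ s)] by exact: finite_seq.
move=> /(_ _ FS); rewrite -fsbig_seq ?undup_uniq //.
have tF : [set` t] `<=` [set` undup (t ++ s)].
  by move=> e /= et; rewrite mem_undup mem_cat et.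
move=> /(_ tF) lt1.
have : \sum_(e <- s) B e e <= \sum_(e <- undup (t ++ s)) B e e.
  apply: ler_sum_sub => //; first exact: undup_uniq.
    by move=> e es; rewrite mem_undup mem_cat es orbT.
  by move=> e es; apply: B0; exact: FS.
rewrite lecE => /andP[_] /le_trans; apply.
set z := (\sum_(e <- undup _) _) in lt1 *.
have : `|z - 1| < (eps%:C)%C by [].
rewrite normc_def ltcR => /ltW le1.
rewrite -lerBlDl; apply: le_trans le1.
apply: le_trans (ler_norm _) _; rewrite -sqrtr_sqr ler_wsqrtr //.
rewrite (_ : complex.Re z - complex.Re 1 = complex.Re (z - 1)) ?lerDl ?sqr_ge0 //.
by case: (z).
Qed.

Lemma density_orth_le s v : uniq s -> orthonormal_set [set` s] -> L2 nu v ->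
  (forall e, e \in s -> inner nu e v = 0) ->
  inner nu v (rho v) <= inner nu v v * (1 - \sum_(e <- s) inner nu e (rho e)).
Proof.
move=> us os Lv vs; have Lrv := rho_L2 Lv; have [Ls s1 s0] := os.
have [_ _ _ I0] := inner_psd nu; have [_ Br Bl _] := density_psd.
(* A null v cannot be normalized; Cauchy-Schwarz for [inner] then gives <v, rho v> = 0. *)
have c0 := I0 _ Lv; have [v0|cn0] := eqVneq (inner nu v v) 0.
  have := psd_form_CS (inner_psd nu) Lv Lrv; rewrite v0 !mul0r => h.
  suff -> : inner nu v (rho v) = 0 by [].
  by apply/eqP; rewrite -normr_eq0 -sqrf_eq0 eq_le h exprn_ge0.
have [a [ar aa]] := normalize Lv cn0; set w := flin a v _ => w1.
have Lw : L2 nu w by apply: L2_lin => //; exact: L2_0.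
have ws e : e \in s -> inner nu e w = 0.
  move=> es; rewrite /w (psd_formZr _ (inner_psd nu)) ?vs ?mulr0 //.
  exact: Ls.
have wns : w \notin s.
  by apply/negP => /ws; rewrite w1 => /eqP; rewrite oner_eq0.
(* w :: s is orthonormal, so the weight of w is at most what s leaves of tr rho *)
have ow : orthonormal_set [set` w :: s].
  split.
  - by move=> e; rewrite /= in_cons => /orP[/eqP ->|/Ls].
  - by move=> e; rewrite /= in_cons => /orP[/eqP ->|/s1].
  - move=> e e'; rewrite /= !in_cons => /orP[/eqP ->|es] /orP[/eqP ->|es'] // ee'.
    + by rewrite (inner_conj (Ls _ es') Lw) ws ?rmorph0.
    + exact: ws.
    + exact: s0.
have := @density_sum_le1 (w :: s); rewrite /= wns us /= big_cons => /(_ isT).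
have -> : inner nu w (rho w) = inner nu v (rho v) / inner nu v v.
  rewrite /w (psd_formZr _ density_psd) // (psd_formZl _ density_psd) //.
  by rewrite ar mulrA aa mulrC.
by move=> /(_ ow); rewrite -lerBrDr ler_pdivrMr ?lt_def ?cn0 // mulrC.
Qed.

(** The case of the empty family, which leaves the whole trace 1. *)
Lemma density_form_le w : L2 nu w -> inner nu w (rho w) <= inner nu w w.
Proof.
move=> Lw; have := @density_orth_le [::] w isT _ Lw.
by rewrite big_nil subr0 mulr1; apply.
Qed.

Lemma density_key s u w : uniq s -> orthonormal_set [set` s] -> L2 nu u -> L2 nu w ->
  `|\sum_(e <- s) inner nu u e * inner nu e (rho w) - inner nu u (rho w)| ^+ 2
    <= inner nu u u * inner nu w w * (1 - \sum_(e <- s) inner nu e (rho e)).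
Proof.
move=> us os Lu Lw; have [Ls _ _] := os; have Lr := resid_L2 Ls Lu.
have [_ _ _ I0] := inner_psd nu; have [_ _ _ B0] := density_psd.
(* The difference is <r, rho w> with r = [resid s u]: Cauchy-Schwarz bounds its square by <r, rho r>
   <w, rho w>, and only the first factor carries the small quantity. *)
rewrite distrC -(psd_residl density_psd) //.
apply: le_trans (psd_form_CS density_psd Lr Lw) _.
rewrite mulrAC; apply: ler_pM.
- exact: B0.
- exact: B0.
- apply: le_trans (density_orth_le us os Lr _) _; first exact: resid_orth.
  by rewrite ler_wpM2r ?subr_ge0 ?density_sum_le1 // resid_le.
- exact: density_form_le.
Qed.

(** X stands for rho |w><u|, of which only the diagonal entries enter the trace. *)
Lemma has_trace_rank1 X u w : L2 nu u -> L2 nu w ->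
  (forall e, L2 nu e -> inner nu e (X e) = inner nu u e * inner nu e (rho w)) ->
  has_trace nu X (inner nu u (rho w)).
Proof.
move=> Lu Lw HX S oS eps eps0; have [_ _ tr] := Hrho.
have [_ _ _ I0] := inner_psd nu.
have K0 : 0 <= inner nu u u * inner nu w w by rewrite mulr_ge0 ?I0.
pose k := complex.Re (inner nu u u * inner nu w w).
have kE : inner nu u u * inner nu w w = (k%:C)%C by apply: eqcP; rewrite ?(ger0_Im K0).
have k0 : 0 <= k by move: K0; rewrite kE ler0c.
have k1 : 0 < k + 1 by rewrite ltr_wpDl.
(* The squared error is at most k times the trace defect, hence below eps^2 k / (k + 1); the + 1
   covers k = 0. *)
have eps'0 : 0 < eps ^+ 2 / (k + 1) by rewrite divr_gt0 ?exprn_gt0.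
have [F0 [fF0 F0S H]] := tr S oS _ eps'0.
exists F0; split=> // F fF F0F FS; have := H F fF F0F FS.
move: fF FS {F0F H} => /finite_fsetP[X' ->] FS.
have us : uniq (finmap.enum_fset X') by exact: finmap.fset_uniq.
rewrite -!fsbig_seq //; move: FS us; set s := finmap.enum_fset X' => FS us.
have [LS [S1 [S0 _]]] := oS.
have os : orthonormal_set [set` s].
  by split=> [e /FS/LS|e /FS/S1|e e' /FS h /FS h']//; exact: S0.
have [Ls _ _] := os.
have -> : \sum_(e <- s) inner nu e (X e) =
    \sum_(e <- s) inner nu u e * inner nu e (rho w).
  by apply: eq_big_seq => e es; rewrite HX //; exact: Ls.
(* The distance of the partial trace from 1 is itself the factor appearing in [density_key]. *)
rewrite distrC ger0_norm ?subr_ge0 ?density_sum_le1 // => lt.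
have le := density_key us os Lu Lw.
have e0 : 0 <= (eps%:C)%C by rewrite ler0c ltW.
suff : `|\sum_(e <- s) inner nu u e * inner nu e (rho w) - inner nu u (rho w)| ^+ 2
    < (eps%:C)%C ^+ 2 by rewrite ltr_pXn2r // nnegrE.
apply: (le_lt_trans le); rewrite kE; apply: (@le_lt_trans _ _ ((k * (eps ^+ 2 / (k + 1)))%:C)%C).
  by rewrite rmorphM /= ler_wpM2l ?ler0c // ltW.
rewrite -rmorphXn /= ltcR mulrA ltr_pdivrMr // mulrC.
by rewrite ltr_pM2l ?exprn_gt0 // ltrDl.
Qed.

End density.
End trace.

(** * Upper level sets and Fubini *)

Section tail.
Context {d : measure_display} {T : measurableType d} {R : realType}.
Variables (nu : probability T R) (f : T -> R).
Hypotheses (mf : measurable_fun setT f) (f0 : forall x, 0 <= f x).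
Local Notation leb := (@lebesgue_measure R).

(* Empty for l < 0, so that integrals over [0, +oo[ become integrals over the
   whole line. *)
Definition tail (l : R) : set T := [set x | 0 <= l < f x].

Lemma measurable_under_graph :
  measurable [set z : T * measurableTypeR R | 0 <= z.2 < f z.1].
Proof.
have m1 : measurable_fun setT (fun z : T * measurableTypeR R => (0 : R) <= z.2).
  exact: measurable_fun_ler.
have m2 : measurable_fun setT (fun z : T * measurableTypeR R => (z.2 : R) < f z.1).
  by apply: measurable_fun_ltr => //; exact: measurableT_comp.
have /(_ measurableT [set true]) := measurable_and m1 m2; move=> /(_ I).
by rewrite setTI.
Qed.

Lemma measurable_tail l : measurable (tail l).
Proof.
have := measurable_ysection l measurable_under_graph.
by congr measurable; apply/seteqP; split => x; rewrite /ysection /= inE.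
Qed.

Definition tind x (l : R) : R := \1_(tail l) x.

Lemma tindE x : tind x = \1_(`[0, f x[%classic : set R).
Proof.
apply/funext => l; rewrite /tind !indicE; congr (_%:R).
Qed.

Lemma tind_ge0 x l : 0 <= tind x l.
Proof. by rewrite /tind indicE. Qed.

Lemma tind_le1 x l : tind x l <= 1.
Proof. by rewrite /tind indicE lern1 leq_b1. Qed.

Lemma integral_indic_itv0 (c : R) : 0 <= c ->
  (\int[leb]_l (\1_(`[0, c[%classic : set R) l)%:E = c%:E)%E.
Proof.
move=> c0; rewrite integral_indic // setIT.
apply: etrans (lebesgue_measure_itv `[0, c[%R) _.
rewrite /= lte_fin; move: c0; rewrite le_eqVlt => /predU1P[<-|->].
  by rewrite ltxx.
by rewrite sube0.
Qed.

Lemma integral_tind x : (\int[leb]_l (tind x l)%:E = (f x)%:E)%E.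
Proof. by rewrite tindE integral_indic_itv0. Qed.

Lemma measurable_tind2 :
  measurable_fun setT (fun z : T * measurableTypeR R => tind z.1 z.2).
Proof.
rewrite (_ : (fun _ => _) =
  \1_([set z : T * measurableTypeR R | 0 <= z.2 < f z.1])); last first.
  by apply/funext => z; rewrite /tind !indicE; congr (_%:R); apply/idP/idP; rewrite !inE.
by apply/measurable_indicP; exact: measurable_under_graph.
Qed.

Lemma measurable_tindl x : measurable_fun setT (tind x : measurableTypeR R -> R).
Proof. by rewrite tindE; apply: measurable_indic; exact: measurable_itv. Qed.

Lemma measurable_tindx l : measurable_fun setT (tind^~ l).
Proof. exact: measurable_indic (measurable_tail l). Qed.

Lemma rintegrable_tind x : rintegrable leb (tind x).
Proof.
apply/integrableP; split; first by apply/measurable_EFinP; exact: measurable_tindl.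
under eq_integral do rewrite /= ger0_norm ?tind_ge0 //.
by rewrite integral_tind ltry.
Qed.

Lemma Rintegral_tind x : \int[leb]_l tind x l = f x.
Proof. by rewrite /Rintegral integral_tind. Qed.

Lemma tind_min x y l : tind x l * tind y l = \1_(`[0, Num.min (f x) (f y)[%classic : set R) l.
Proof.
rewrite /tind !indicE -natrM mulnb; congr (_%:R); congr nat_of_bool.
apply/idP/idP; rewrite ?inE /tail /= in_itv /= lt_min.
  by move/andP; rewrite !inE /tail /= => -[/andP[-> ->] /andP[_ ->]].
by move=> /and3P[h0 h1 h2]; apply/andP; rewrite !inE /tail /= h0 h1 h2.
Qed.

Lemma Rintegral_tind_min x y : \int[leb]_l (tind x l * tind y l) = Num.min (f x) (f y).
Proof.
under eq_Rintegral do rewrite tind_min.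
by rewrite /Rintegral integral_indic_itv0 // le_min !f0.
Qed.

(** Fubini for P(x, l) = b(x) chi_{f>l}(x) h(l) on l >= 0. The bounded weight h is later taken to be
    1, [tind f y] and [tint f b], which give the integrability of [tint], the formula for [tquant]
    and the pairing with a second function. *)
Lemma tail_fubini (b : T -> R) (h : R -> R) (K : R) :
  rintegrable nu b -> rintegrable nu (fun x => b x * f x) ->
  measurable_fun setT (h : measurableTypeR R -> R) -> (forall l, `|h l| <= K) ->
  [/\ rintegrable leb (fun l => h l * \int[nu]_x (b x * tind x l)),
    rintegrable nu (fun x => b x * \int[leb]_l (tind x l * h l)) &
    \int[nu]_x (b x * \int[leb]_l (tind x l * h l)) =
    \int[leb]_l (h l * \int[nu]_x (b x * tind x l))].
Proof.
move=> ib ibf mh hK; have mb := rintegrable_mfun ib.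
have K0 : 0 <= K by exact: le_trans (hK 0).
have ith x : rintegrable leb (fun l => tind x l * h l).
  apply: rintegrable_le (rintegrableZ K (rintegrable_tind x)) _.
  - by apply: measurable_funM => //; exact: measurable_tindl.
  - by move=> l; rewrite normrM ger0_norm ?tind_ge0 // mulrC ler_wpM2r ?tind_ge0.
have ibt l : rintegrable nu (fun x => b x * tind x l).
  apply: (@rintegrable_le _ _ _ _ _ (fun x => `|b x|)).
  - by apply: measurable_funM => //; exact: measurable_tindx.
  - exact: (integrable_norm ib).
  - move=> x; rewrite normrM [`|tind _ _|]ger0_norm ?tind_ge0 //.
    by rewrite ler_piMr ?tind_le1.
pose P (z : T * measurableTypeR R) := (b z.1 * (tind z.1 z.2 * h z.2))%:E.
(* All sections are integrable, so [fine] loses nothing and the extended integrals are the real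
   ones. *)
have FE : fubini_F leb P = fun x => (b x * \int[leb]_l (tind x l * h l))%:E.
  apply/funext => x; rewrite /fubini_F /P /= -RintegralZl //; last exact: ith.
  rewrite /Rintegral fineK // integrable_fin_num //.
  exact: rintegrableZ (ith x).
have GE : fubini_G nu P = fun l => (h l * \int[nu]_x (b x * tind x l))%:E.
  apply/funext => l; rewrite /fubini_G /P /= -RintegralZl //; last exact: ibt.
  rewrite /Rintegral fineK; last first.
    by rewrite integrable_fin_num //; exact: rintegrableZ (ibt l).
  by apply: eq_integral => x _; congr EFin; ring.
have mP : measurable_fun setT P.
  apply/measurable_EFinP; apply: measurable_funM; first exact: measurableT_comp.
  by apply: measurable_funM; [exact: measurable_tind2|exact: measurableT_comp].
have iP : (nu \x leb)%E.-integrable setT P.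
  apply/(integrable12ltyP nu leb mP).
  (* For fixed x the integral of |P| over l is at most K |b(x)| f(x), because chi_{f>l}(x)
     integrates to f(x). *)
  apply: (@le_lt_trans _ _ (\int[nu]_x (K * `|b x * f x|)%:E)%E); last first.
    have : rintegrable nu (fun x => K * `|b x * f x|).
      by apply: rintegrableZ; exact: (integrable_norm ibf).
    move=> /integrableP[_]; under eq_integral => x _.
      rewrite /= ger0_norm; last by rewrite mulr_ge0.
      over.
    by [].
  apply: ge0_le_integral => //.
  - by move=> x _; exact: integral_ge0.
  - apply: (measurable_fun_fubini_tonelli_F (abse \o P)) => //=.
    exact: measurableT_comp.
  - apply/measurable_EFinP; apply: measurable_funM => //.
    by apply: measurableT_comp => //; apply: measurable_funM.
  move=> x _; apply: (@le_trans _ _ (\int[leb]_l ((K * `|b x|) * tind x l)%:E)%E).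
    apply: ge0_le_integral => //.
    - by apply: measurableT_comp => //; exact: measurableT_comp mP (pair1_measurable x).
    - by apply/measurable_EFinP; apply: measurable_funM => //; exact: measurable_tindl.
    move=> l _; rewrite /P /= lee_fin !normrM [`|tind _ _|]ger0_norm ?tind_ge0 //.
    rewrite [leRHS]mulrAC [leRHS]mulrC ler_wpM2l // mulrC.
    by rewrite ler_wpM2r ?tind_ge0.
  rewrite (_ : (fun l => _) = (fun l => (K * `|b x|)%:E * (tind x l)%:E)%E) //.
  rewrite ge0_integralZl //; last 3 first.
  - by apply/measurable_EFinP; exact: measurable_tindl.
  - by move=> l _; rewrite lee_fin tind_ge0.
  - by rewrite lee_fin mulr_ge0.
  by rewrite integral_tind lee_fin normrM [`|f x|]ger0_norm // mulrA.
split.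
- have mG := measurable_fubini_G iP.
  apply/integrableP; split; first by move: mG; rewrite GE.
  rewrite (_ : EFin \o _ = fubini_G nu P); last by rewrite GE.
  apply: le_lt_trans ((integrable21ltyP nu leb mP).1 iP).
  apply: ge0_le_integral => //.
  - exact: measurableT_comp.
  - apply: (measurable_fun_fubini_tonelli_G (abse \o P)) => //=.
    exact: measurableT_comp.
  - move=> l _; apply: le_abse_integral => //.
    exact: measurableT_comp mP (pair2_measurable l).
- by have := integrable_fubini_F iP; rewrite FE.
- by have := Fubini iP; rewrite -/(fubini_F leb P) -/(fubini_G nu P) FE GE => /(congr1 fine).
Qed.

End tail.

(** * Characteristic functions and the operators mu(A) *)

Section chi.
Context {d : measure_display} {T : measurableType d} {R : realType}.
Variable nu : probability T R.
Implicit Types (u v w e : T -> R[i]) (A : set T).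

Definition chi A : T -> R[i] := fun x => ((\1_A x)%:C)%C.

Lemma rintegrable_cst (c : R) : rintegrable nu (fun=> c).
Proof.
by apply: finite_measure_integrable_cst.
Qed.

Lemma L2_real (g : T -> R) : measurable_fun setT g ->
  rintegrable nu (fun x => g x ^+ 2) -> L2 nu (fun x => ((g x)%:C)%C).
Proof.
move=> mg ig; apply: L2P => //=.
by rewrite (_ : sqn _ = fun x => g x ^+ 2) //; apply/funext => x;
  rewrite /sqn /= expr0n /= addr0.
Qed.

Lemma L2_chi A : measurable A -> L2 nu (chi A).
Proof.
move=> mA; have m1 : measurable_fun setT (\1_A : T -> R) by exact: measurable_indic.
apply: L2_real => //; apply: rintegrable_le (rintegrable_cst 1) _.
  exact: measurable_funX.
move=> x; rewrite normrX exprn_ile1 // indicE.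
by case: (x \in A); rewrite ?normr1 ?normr0.
Qed.

Lemma Re_integrable u (g : T -> R) : L2 nu u -> measurable_fun setT g ->
  rintegrable nu (fun x => g x ^+ 2) ->
  rintegrable nu (fun x => complex.Re (u x) * g x).
Proof.
move=> Lu mg ig; have [mr _] := Lu.
apply: (L2_mulr Lu (L2_real mg ig)) => // x.
  by rewrite /sqn lerDl sqr_ge0.
by rewrite /sqn /= lerDl sqr_ge0.
Qed.

Lemma Im_integrable u (g : T -> R) : L2 nu u -> measurable_fun setT g ->
  rintegrable nu (fun x => g x ^+ 2) ->
  rintegrable nu (fun x => complex.Im (u x) * g x).
Proof.
move=> Lu mg ig; have [_ [mi _]] := Lu.
apply: (L2_mulr Lu (L2_real mg ig)) => // x.
  by rewrite /sqn lerDr sqr_ge0.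
by rewrite /sqn /= lerDl sqr_ge0.
Qed.

(** The measure is finite, so the constant 1 is square integrable and may be paired with u. *)
Lemma L2_L1 u : L2 nu u -> rintegrable nu (fun x => complex.Re (u x)) /\
  rintegrable nu (fun x => complex.Im (u x)).
Proof.
move=> Lu; have i1 : rintegrable nu (fun x => 1 ^+ 2) by exact: rintegrable_cst.
split.
  have := Re_integrable (g := fun=> 1) Lu (measurable_cst _) i1.
  by under eq_fun do rewrite mulr1.
have := Im_integrable (g := fun=> 1) Lu (measurable_cst _) i1.
by under eq_fun do rewrite mulr1.
Qed.

Lemma inner_chi A u : inner nu (chi A) u =
  Complex (\int[nu]_x (complex.Re (u x) * \1_A x))
          (\int[nu]_x (complex.Im (u x) * \1_A x)).
Proof.
rewrite /inner /cint; congr Complex; apply: eq_Rintegral => x _.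
  by rewrite conjcE creM /=; ring.
by rewrite conjcE cimM /=; ring.
Qed.

(** mu(A) is the rank-one operator |chi_A><chi_A|, which brings it under [has_trace_rank1]. *)
Lemma muopE A u : muop nu A u = flin (inner nu (chi A) u) (chi A) (fun=> 0).
Proof.
apply/funext => x; rewrite /muop /flin /chi addr0; congr (_ * _).
rewrite cint_indic; apply: eq_cint => y _; congr (_ * _).
by rewrite conjcE /= oppr0.
Qed.

Lemma mu_rhoE (rho : operator T R) A : density nu rho -> measurable A ->
  mu_rho nu rho A = inner nu (chi A) (rho (chi A)).
Proof.
move=> Hrho mA; have LA := L2_chi mA; apply: has_traceE.
apply: (has_trace_rank1 Hrho) => // e Le; rewrite muopE.
exact: (psd_formZr _ (density_psd Hrho)).
Qed.

End chi.

(** * The quantization as an integral over levels *)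

Section tail_integral.
Context {d : measure_display} {T : measurableType d} {R : realType}.
Variables (nu : probability T R) (f : T -> R).
Hypotheses (mf : measurable_fun setT f) (f0 : forall x, 0 <= f x).
Hypothesis f2 : rintegrable nu (fun x => f x ^+ 2).
Local Notation leb := (@lebesgue_measure R).
Implicit Types (a b : T -> R) (u v w e : T -> R[i]).

(** For real b this is <chi_{f>l}, b> when l >= 0, and 0 when l < 0. Complex vectors are handled by
    components, Fubini being applied to real functions. *)
Definition tint b (l : R) : R := \int[nu]_x (b x * tind f x l).

Definition tail_integrable b := rintegrable nu b /\ rintegrable nu (fun x => b x * f x).

Lemma tail_integrable_Re u : L2 nu u -> tail_integrable (fun x => complex.Re (u x)).
Proof. by move=> Lu; split; [case: (L2_L1 Lu)|exact: Re_integrable]. Qed.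

Lemma tail_integrable_Im u : L2 nu u -> tail_integrable (fun x => complex.Im (u x)).
Proof. by move=> Lu; split; [case: (L2_L1 Lu)|exact: Im_integrable]. Qed.

Lemma tail_integrable_1 : tail_integrable (fun=> 1).
Proof.
have := tail_integrable_Re (L2_chi nu (@measurableT _ T)).
by rewrite /chi /= (_ : (fun x => \1_setT x) = fun=> 1) //;
  apply/funext => x; rewrite indicE in_setT.
Qed.

(** A bound uniform in l, so that [tint b] can itself serve as the weight h in [tail_fubini]. *)
Lemma tint_bound b l : tail_integrable b -> `|tint b l| <= \int[nu]_x `|b x|.
Proof.
move=> [ib _]; have mb := rintegrable_mfun ib.
have ibt : rintegrable nu (fun x => b x * tind f x l).
  apply: rintegrable_le (integrable_norm ib) _.
    by apply: measurable_funM => //; exact: measurable_tindx.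
  move=> x; rewrite normrM [`|tind _ _ _|]ger0_norm ?tind_ge0 //.
  by rewrite ler_piMr ?tind_le1.
apply: le_trans (le_normr_Rintegral measurableT ibt) _.
apply: le_Rintegral => //.
- exact: (integrable_norm ibt).
- exact: (integrable_norm ib).
move=> x _; rewrite normrM [`|tind _ _ _|]ger0_norm ?tind_ge0 //.
by rewrite ler_piMr ?tind_le1.
Qed.

Lemma tint_integrable b : tail_integrable b -> rintegrable leb (tint b).
Proof.
move=> [ib ibf]; have n1 (l : R) : `|(1 : R)| <= 1 by rewrite normr1.
have [+ _ _] := tail_fubini mf f0 ib ibf (measurable_cst (1 : R)) n1.
by under eq_fun do rewrite mul1r.
Qed.

Lemma tint_measurable b : tail_integrable b -> measurable_fun setT (tint b : measurableTypeR R -> R).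
Proof. by move=> /tint_integrable /rintegrable_mfun. Qed.

Definition tquant b y : R := \int[nu]_x (Num.min (f x) (f y) * b x).

Lemma tquantE b y : tail_integrable b -> tquant b y = \int[leb]_l (tind f y l * tint b l).
Proof.
move=> [ib ibf]; have n1 l : `|tind f y l| <= 1.
  by rewrite ger0_norm ?tind_ge0 ?tind_le1.
have [_ _ <-] := tail_fubini mf f0 ib ibf (measurable_tindl f y) n1.
by apply: eq_Rintegral => x _; rewrite Rintegral_tind_min // mulrC.
Qed.

Lemma tquant_integral a b : tail_integrable a -> tail_integrable b ->
  [/\ rintegrable leb (fun l => tint a l * tint b l),
      rintegrable nu (fun y => a y * tquant b y) &
      \int[nu]_y (a y * tquant b y) = \int[leb]_l (tint a l * tint b l)].
Proof.
move=> [ia iaf] tb.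
have [i1 i2 i3] := tail_fubini mf f0 ia iaf (tint_measurable tb)
  (fun l => tint_bound l tb).
have -> : tquant b = fun y => \int[leb]_l (tind f y l * tint b l).
  by apply/funext => y; exact: tquantE.
have -> : (fun l => tint a l * tint b l) = fun l => tint b l * tint a l.
  by apply/funext => l; exact: mulrC.
by split.
Qed.

Lemma tquant_measurable b : tail_integrable b -> measurable_fun setT (tquant b).
Proof.
(* Measurability is read off the integrability of 1 times [tquant b]. *)
move=> tb; have [_ /rintegrable_mfun + _] := tquant_integral tail_integrable_1 tb.
by under eq_fun do rewrite mul1r.
Qed.

(** Each [tint b l] is at most the L_1 norm of b, and [tind f y] integrates to f(y). As f is square
    integrable, this makes the quantization preserve L_2. *)
Lemma tquant_le b y : tail_integrable b -> `|tquant b y| <= \int[nu]_x `|b x| * f y.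
Proof.
move=> tb; have mt := tint_measurable tb.
rewrite tquantE //; set K := \int[nu]_x _.
have h l : `|tind f y l * tint b l| <= K * tind f y l.
  rewrite normrM [`|tind _ _ _|]ger0_norm ?tind_ge0 // mulrC.
  by rewrite ler_wpM2r ?tind_ge0 //; exact: tint_bound.
have iK : rintegrable leb (fun l => K * tind f y l).
  by apply: rintegrableZ; exact: rintegrable_tind.
have it : rintegrable leb (fun l => tind f y l * tint b l).
  by apply: rintegrable_le iK h; apply: measurable_funM => //;
    exact: measurable_tindl.
apply: le_trans (le_normr_Rintegral measurableT it) _.
apply: le_trans (_ : _ <= \int[leb]_l (K * tind f y l)) _.
  apply: le_Rintegral => //.
  exact: (integrable_norm it).
by rewrite RintegralZl ?Rintegral_tind //; exact: rintegrable_tind.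
Qed.

Lemma quantE u : quant nu f u = fun y =>
  Complex (tquant (fun x => complex.Re (u x)) y)
          (tquant (fun x => complex.Im (u x)) y).
Proof.
apply/funext => y; rewrite /quant /cint.
congr Complex; apply: eq_Rintegral => x _.
  by rewrite creM /=; ring.
by rewrite cimM /=; ring.
Qed.

Lemma quant_L2 u : L2 nu u -> L2 nu (quant nu f u).
Proof.
move=> Lu; rewrite quantE; have tr := tail_integrable_Re Lu; have ti := tail_integrable_Im Lu.
have mr := tquant_measurable tr; have mi := tquant_measurable ti.
apply: L2P => //.
set p := fun x : T => complex.Re (u x); set q := fun x => complex.Im (u x).
apply: (rintegrable_le (g := fun y =>
  ((\int[nu]_x `|p x|) ^+ 2 + (\int[nu]_x `|q x|) ^+ 2) * f y ^+ 2)).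
- by apply: measurable_funD; apply: measurable_funX.
- exact: rintegrableZ.
move=> y; rewrite ger0_norm ?sqn_ge0 // /sqn /= mulrDl -!exprMn.
have sq (x z : R) : `|x| <= z -> x ^+ 2 <= z ^+ 2.
  by move=> xz; rewrite -real_normK ?num_real // ler_pXn2r // nnegrE // (le_trans _ xz).
by apply: lerD; apply: sq; exact: tquant_le.
Qed.

Lemma inner_chi_tail u l : inner nu (chi (tail f l)) u =
  Complex (tint (fun x => complex.Re (u x)) l) (tint (fun x => complex.Im (u x)) l).
Proof. exact: inner_chi. Qed.

Lemma L2_chi_tail l : L2 nu (chi (tail f l)).
Proof. exact: L2_chi (measurable_tail mf l). Qed.

(** The weak identity: the quantization of f is the integral over l of |chi_{f>l}><chi_{f>l}|. Each
    of the two components of F combines two of the four real pairings from [tquant_integral]. *)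
Lemma inner_quant v u : L2 nu v -> L2 nu u ->
  let F l := inner nu v (chi (tail f l)) * inner nu (chi (tail f l)) u in
  cintegrable leb F /\ inner nu v (quant nu f u) = cint leb setT F.
Proof.
move=> Lv Lu F.
have FE l : F l = Complex
   (tint (fun x => complex.Re (v x)) l * tint (fun x => complex.Re (u x)) l +
    tint (fun x => complex.Im (v x)) l * tint (fun x => complex.Im (u x)) l)
   (tint (fun x => complex.Re (v x)) l * tint (fun x => complex.Im (u x)) l -
    tint (fun x => complex.Im (v x)) l * tint (fun x => complex.Re (u x)) l).
  rewrite /F (inner_conj (L2_chi_tail l) Lv) !inner_chi_tail conjcE /=.
  by apply: eqcP; rewrite ?creM ?cimM /=; ring.
have [r1 r2 r3] := tquant_integral (tail_integrable_Re Lv) (tail_integrable_Re Lu).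
have [s1 s2 s3] := tquant_integral (tail_integrable_Im Lv) (tail_integrable_Im Lu).
have [t1 t2 t3] := tquant_integral (tail_integrable_Re Lv) (tail_integrable_Im Lu).
have [w1 w2 w3] := tquant_integral (tail_integrable_Im Lv) (tail_integrable_Re Lu).
have -> : F = _ := funext FE.
split.
  by split; [exact: rintegrableD|exact: rintegrableB].
rewrite quantE; apply: eqcP; rewrite /inner /cint /=.
- rewrite (RintegralD _ r1 s1) // -r3 -s3 -RintegralD //.
  by apply: eq_Rintegral => y _; rewrite conjcE creM /=; ring.
- rewrite (RintegralB _ t1 w1) // -t3 -w3 -RintegralB //.
  by apply: eq_Rintegral => y _; rewrite conjcE cimM /=; ring.
Qed.

End tail_integral.

(** With both components bounded by K, the modulus is at most sqrt 2 K; the factor 2 is a convenient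
    weakening. *)
Lemma cint_le {d : measure_display} {T : measurableType d} {R : realType}
    (mu : {measure set T -> \bar R}) (u : T -> R[i]) (g : T -> R) :
  cintegrable mu u -> rintegrable mu g ->
  (forall x, `|complex.Re (u x)| <= g x) -> (forall x, `|complex.Im (u x)| <= g x) ->
  `|cint mu setT u| <= ((2 * \int[mu]_x g x)%:C)%C.
Proof.
move=> [ur ui] ig hr hi.
have bound (h : T -> R) : rintegrable mu h -> (forall x, `|h x| <= g x) ->
    `|\int[mu]_x h x| <= \int[mu]_x g x.
  move=> ih hg; apply: le_trans (le_normr_Rintegral measurableT ih) _.
  by apply: le_Rintegral => //; exact: (integrable_norm ih).
have br := bound _ ur hr; have bi := bound _ ui hi.
set K := \int[mu]_x g x in br bi *; rewrite normc_def lecR /cint /=.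
set p := \int[mu]_x _ in br *; set q := \int[mu]_x _ in bi *.
have K0 : 0 <= K by exact: le_trans br.
rewrite -[leRHS]ger0_norm ?mulr_ge0 // -sqrtr_sqr ler_wsqrtr //.
have sq (x : R) : `|x| <= K -> x ^+ 2 <= K ^+ 2.
  by move=> xK; rewrite -[x ^+ 2]real_normK ?num_real // ler_pXn2r // nnegrE.
rewrite exprMn; have := sq _ br; have := sq _ bi; have := sqr_ge0 K.
set a := p ^+ 2; set b := q ^+ 2; set c := K ^+ 2.
by rewrite (_ : 2 ^+ 2 = 4 :> R) //; [lra|ring].
Qed.

(** * The tail-sum formula *)

Section tail_sum.
Context {d : measure_display} {T : measurableType d} {R : realType}.
Variables (nu : probability T R) (rho : operator T R) (f : T -> R).
Hypothesis Hrho : density nu rho.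
Hypotheses (mf : measurable_fun setT f) (f0 : forall x, 0 <= f x).
Hypothesis f2 : rintegrable nu (fun x => f x ^+ 2).
Local Notation leb := (@lebesgue_measure R).
Local Notation ch := (fun l => chi (R := R) (tail f l)).
Implicit Types (s : seq (T -> R[i])).

(** For l >= 0, [m l] is mu_rho(f > l) and [N l] is nu(f > l), the squared norm of chi_{f>l}; both
    vanish for l < 0. [Sm s] approximates [m] along the family s, and [delta s] is the part of the
    trace that s leaves. *)
Let m l := inner nu (ch l) (rho (ch l)).
Let Sm s l := \sum_(e <- s) inner nu (ch l) e * inner nu e (rho (ch l)).
Let delta s := complex.Re (1 - \sum_(e <- s) inner nu e (rho e)).
Let N l : R := tint nu f (fun=> 1) l.

Let Lch l : L2 nu (ch l). Proof. exact: L2_chi_tail. Qed.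

Let N_integrable : rintegrable leb N.
Proof. by apply: tint_integrable => //; exact: tail_integrable_1. Qed.

Let N0 l : 0 <= N l.
Proof. by apply: Rintegral_ge0 => x _; rewrite mul1r tind_ge0. Qed.

Let innerN l : inner nu (ch l) (ch l) = ((N l)%:C)%C.
Proof.
rewrite inner_self; congr Complex; apply: eq_Rintegral => x _.
rewrite /sqn /chi /= mul1r /tind expr0n /= addr0 indicE.
by case: (x \in _); rewrite ?expr1n ?expr0n.
Qed.

Let deltaE s : uniq s -> orthonormal_set nu [set` s] ->
  1 - \sum_(e <- s) inner nu e (rho e) = ((delta s)%:C)%C.
Proof.
move=> us os; apply: eqcP => //=; apply: ger0_Im.
by rewrite subr_ge0 density_sum_le1.
Qed.

Let delta0 s : uniq s -> orthonormal_set nu [set` s] -> 0 <= delta s.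
Proof.
by move=> us os; rewrite -ler0c -deltaE // subr_ge0 density_sum_le1.
Qed.

(** [density_key] with both vectors equal to chi_{f>l}. The error splits into a factor depending
    only on s and the integrable function N, which permits passing to the limit under the
    integral. *)
Let Sm_close s l : uniq s -> orthonormal_set nu [set` s] ->
  `|complex.Re (Sm s l - m l)| <= Num.sqrt (delta s) * N l /\
  `|complex.Im (Sm s l - m l)| <= Num.sqrt (delta s) * N l.
Proof.
move=> us os; have := density_key Hrho us os (Lch l) (Lch l).
rewrite -/(Sm s l) -/(m l) innerN deltaE // -add_Re2_Im2 -!rmorphM /= lecR.
set p := complex.Re _; set q := complex.Im _ => h.
have sD : 0 <= Num.sqrt (delta s) * N l by rewrite mulr_ge0 ?sqrtr_ge0.
have h' : p ^+ 2 + q ^+ 2 <= (Num.sqrt (delta s) * N l) ^+ 2.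
  by rewrite exprMn sqr_sqrtr ?delta0 // mulrC expr2.
have sq (x : R) : x ^+ 2 <= (Num.sqrt (delta s) * N l) ^+ 2 ->
    `|x| <= Num.sqrt (delta s) * N l.
  by rewrite -[x ^+ 2]real_normK ?num_real // ler_pXn2r // nnegrE.
by split; apply: sq; apply: le_trans h'; rewrite ?lerDl ?lerDr sqr_ge0.
Qed.

(** A basis may be uncountable, while measurability survives only sequential limits; this lets a
    sequence of finite families be chosen. *)
Let delta_small eps : 0 < eps ->
  exists s, [/\ uniq s, orthonormal_set nu [set` s] & delta s < eps].
Proof.
move=> eps0; have [|S oS _] := @onb_extend _ _ _ nu set0; first by split.
have [LS [S1 [S0 _]]] := oS; have [_ _ tr] := Hrho.
have [F0 [/finite_fsetP[X ->] XS H]] := tr S oS _ eps0.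
have us : uniq (finmap.enum_fset X) by exact: finmap.fset_uniq.
exists (finmap.enum_fset X); have os : orthonormal_set nu [set` finmap.enum_fset X].
  by split=> [e /XS/LS|e /XS/S1|e e' /XS h /XS h']//; exact: S0.
split=> //; have := H _ (finite_fset X) (@subset_refl _ _) XS.
rewrite -fsbig_seq // distrC deltaE // ger0_norm ?ler0c ?delta0 //.
by rewrite ltcR.
Qed.

(** By Hermitian symmetry <e, rho f^ e> = <rho e, f^ e>, so [inner_quant] applies with v = rho e,
    term by term. *)
Let Sm_integral s : (forall e, e \in s -> L2 nu e) ->
  cintegrable leb (Sm s) /\
  \sum_(e <- s) inner nu e (rho (quant nu f e)) = cint leb setT (Sm s).
Proof.
elim: s => [|e s IH] Ls.
  have -> : Sm [::] = fun=> 0 by apply/funext => l; rewrite /Sm big_nil.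
  split; first by split; exact: integrable0.
  by rewrite big_nil /cint /= Rintegral_cst // mul0r.
have [] := IH; first by move=> e' es; apply: Ls; rewrite in_cons es orbT.
move=> is_ Es; have Le : L2 nu e by apply: Ls; rewrite mem_head.
have Lr := rho_L2 Hrho Le; have Lq := quant_L2 mf f0 f2 Le.
have [ie Ee] := inner_quant mf f0 f2 Lr Le.
have SE : Sm (e :: s) =
    flin 1 (fun l => inner nu (rho e) (ch l) * inner nu (ch l) e) (Sm s).
  apply/funext => l; rewrite /Sm big_cons /flin mul1r; congr (_ + _).
  rewrite mulrC; congr (_ * _).
  by rewrite (psd_form_conj (density_psd Hrho) (Lch l) Le)
    (inner_conj (Lch l) Lr).
rewrite SE; split; first exact: cintegrable_lin.
rewrite cint_lin // mul1r big_cons Es; congr (_ + _); rewrite -Ee.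
by rewrite (psd_form_conj (density_psd Hrho) Lq Le) (inner_conj Lq Lr).
Qed.

Let m_integrable : cintegrable leb m.
Proof.
have m0 l : 0 <= m l by have [_ _ _] := density_psd Hrho; apply.
split; last first.
  rewrite (_ : (fun l => _) = fun=> 0); first exact: integrable0.
  by apply/funext => l; exact: ger0_Im.
apply: rintegrable_le N_integrable _; last first.
  move=> l; have := density_form_le Hrho (Lch l).
  rewrite -/(m l) innerN => ml; move: (m0 l) ml; rewrite !lecE /=.
  by move=> /andP[_ h0] /andP[_ h1]; rewrite ger0_norm.
(* measurability: m is the pointwise limit of the finite sums Sm (s n) *)
have /choice [s sP] : forall n : nat, exists s,
    [/\ uniq s, orthonormal_set nu [set` s] & delta s < n.+1%:R^-1 ^+ 2].
  by move=> n; apply: delta_small; rewrite exprn_gt0.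
apply: (@measurable_fun_cvg _ _ _ _ (fun n l => complex.Re (Sm (s n) l))).
  move=> n; have [us [Ls _ _] _] := sP n.
  by have [[/rintegrable_mfun]] := Sm_integral Ls.
move=> l _; apply/cvgrPdist_le => eps eps0.
near=> n; have [us os ds] := sP n.
have [+ _] := Sm_close l us os.
rewrite (_ : complex.Re (Sm (s n) l - m l) =
  complex.Re (Sm (s n) l) - complex.Re (m l)); last by case: (Sm _ _); case: (m l).
rewrite distrC => /le_trans; apply.
(* The square in the choice of [s n] compensates this square root. *)
have le1 : Num.sqrt (delta (s n)) <= n.+1%:R^-1.
  rewrite -[leRHS]ger0_norm // -sqrtr_sqr ler_wsqrtr //.
  exact: ltW.
apply: (@le_trans _ _ (n.+1%:R^-1 * N l)); first by rewrite ler_wpM2r.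
rewrite mulrC ler_pdivrMr // mulrC -ler_pdivrMr //.
rewrite (@le_trans _ _ n%:R) ?ler_nat //; near: n.
exact: nbhs_infty_ger.
Unshelve. all: by end_near.
Qed.

Lemma has_trace_quant :
  has_trace nu (fun u => rho (quant nu f u)) (cint leb setT m).
Proof.
move=> S oS eps eps0; have [LS [S1 [S0 _]]] := oS; have [_ _ tr] := Hrho.
pose K := \int[leb]_l N l; have K0 : 0 <= K by exact: Rintegral_ge0.
have c0 : 0 < 2 * K + 1 by rewrite ltr_wpDl ?mulr_ge0.
(* The error is at most 2 K sqrt(delta s), where sqrt(delta s) <= eps / (2 K + 1); this stays below
   eps even for K = 0. *)
have eps'0 : 0 < (eps / (2 * K + 1)) ^+ 2 by rewrite exprn_gt0 ?divr_gt0.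
have [F0 [fF0 F0S H]] := tr S oS _ eps'0.
exists F0; split=> // F fF F0F FS; have := H F fF F0F FS.
move: fF FS {F0F H} => /finite_fsetP[X' ->] FS.
have us : uniq (finmap.enum_fset X') by exact: finmap.fset_uniq.
rewrite -!fsbig_seq //; move: FS us; set s := finmap.enum_fset X' => FS us.
have os : orthonormal_set nu [set` s].
  by split=> [e /FS/LS|e /FS/S1|e e' /FS h /FS h']//; exact: S0.
have [Ls _ _] := os; have [iS ->] := Sm_integral Ls.
rewrite distrC deltaE // ger0_norm ?ler0c ?delta0 // ltcR => lt.
have -> : cint leb setT (Sm s) - cint leb setT m =
    cint leb setT (flin (-1) m (Sm s)).
  by rewrite (cint_lin (-1) m_integrable iS) mulN1r addrC.
have iN : rintegrable leb (fun l => Num.sqrt (delta s) * N l).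
  exact: rintegrableZ.
apply: le_lt_trans (cint_le (cintegrable_lin (-1) m_integrable iS) iN _ _) _.
- by move=> l; rewrite /flin mulN1r addrC; have [] := Sm_close l us os.
- by move=> l; rewrite /flin mulN1r addrC; have [] := Sm_close l us os.
rewrite ltcR RintegralZl // -/K mulrCA.
have h : Num.sqrt (delta s) <= eps / (2 * K + 1).
  have e0 : 0 <= eps / (2 * K + 1) by rewrite ltW // divr_gt0.
  by rewrite -[leRHS](ger0_norm e0) -sqrtr_sqr ler_wsqrtr // ltW.
apply: (@le_lt_trans _ _ (eps / (2 * K + 1) * (2 * K))).
  by rewrite ler_wpM2r ?mulr_ge0.
by rewrite mulrAC ltr_pdivrMr // ltr_pM2l // ltrDl.
Qed.

Lemma qint_tail : qint nu rho f = cint leb setT m.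
Proof. exact: has_traceE has_trace_quant. Qed.

Lemma tail_integral : cint leb `[0, +oo[ (fun l => mu_rho nu rho [set x | l < f x]) =
  cint leb setT m.
Proof.
rewrite cint_indic; apply: eq_cint => l _; rewrite indicE.
(* For l >= 0 the two level sets coincide. For l < 0 the indicator of the half-line is 0 on one side
   and the tail is empty on the other, so the integrands agree on the whole line. *)
have [l0|l0] := leP 0 l.
  have tE : [set x | l < f x] = tail f l.
    by apply/seteqP; split => x; rewrite /tail /= l0.
  rewrite mem_set /= ?in_itv /= ?l0 // tE (mu_rhoE Hrho) ?mul1r //.
  exact: measurable_tail.
rewrite memNset /= ?in_itv /= ?andbT ?leNgt ?l0 // mul0r /m.
rewrite (_ : chi (tail f l) = fun=> 0) ?(psd_form0l (inner_psd nu)) //.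
  exact: rho_L2 (L2_0 nu).
apply/funext => x; rewrite /chi indicE memNset // /tail /= leNgt l0.
by [].
Qed.

End tail_sum.

Unset Implicit Arguments.

Theorem theorem3p4 (R : realType) (d : measure_display) (Omega : measurableType d)
  (nu : probability Omega R) (rho : operator Omega R) (f : Omega -> R) :
  density nu rho ->
  measurable_fun setT f ->
  (\int[nu]_x ((f x) ^+ 2)%:E < +oo)%E ->
  (forall x, 0 <= f x) ->
  qint nu rho f =
  cint lebesgue_measure `[0%R, +oo[%classic
    (fun lambda : R => mu_rho nu rho [set x | lambda < f x]).
Proof.
move=> Hrho mf f2 f0; have if2 : rintegrable nu (fun x => f x ^+ 2).
  apply/integrableP; split; first by apply/measurable_EFinP; exact: measurable_funX.
  by under eq_integral do rewrite /= ger0_norm ?sqr_ge0 //.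
by rewrite (qint_tail Hrho mf f0 if2) -(tail_integral Hrho mf).
Qed.
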